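(* Let $\mathcal G$ be a connected compact metric graph, let $\mathcal V^D\subseteq\mathcal V$ be a nonempty set of degree-one vertices, and let $1<p<\infty$. Then there exists a unique $p$-torsion function $w_p\in W^{1,p}_{\mathcal V^D}(\mathcal G)$.
   Context: A compact metric graph $\mathcal G$ is obtained from a finite combinatorial graph with vertex set $\mathcal V$ and finite edge set $\mathcal E$ by identifying the endpoints of compact intervals $[0,\ell_e]$, $\ell_e>0$, $e\in\mathcal E$, according to the graph structure; $|\mathcal G|=\sum_{e}\ell_e$. $\mathcal E_v$ is the set of edges incident with $v$ (a loop at $v$ counted twice, once for each endpoint) and $\deg(v)=|\mathcal E_v|$. Set $\mathcal V^N=\mathcal V\setminus\mathcal V^D$. $u_e$ denotes the restriction of $u$ to $e$. $W^{1,p}(\mathcal G)$ is the space of $u:\mathcal G\to\mathbb R$ with $u|_e\in W^{1,p}(0,\ell_e)$ for all $e\in\mathcal E$ and $u$ continuous at every vertex; $W^{1,p}_{\mathcal V^D}(\mathcal G)=\{u\in W^{1,p}(\mathcal G): u(v)=0\ \forall v\in\mathcal V^D\}$. A function $w_p\in W^{1,p}_{\mathcal V^D}(\mathcal G)$ is called a $p$-torsion function of $\mathcal G$ if $$-(|w_{p,e}'|^{p-2}w_{p,e}')'=1\ \text{ on each } e\in\mathcal E,\qquad w_p(v)=0\ \text{ for } v\in\mathcal V^D,\qquad \sum_{e\in\mathcal E_v}|w_{p,e}'(v)|^{p-2}\partial_{\nu_e}w_{p,e}(v)=0\ \text{ for } v\in\mathcal V^N,$$ where $\partial_{\nu_e}$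 is the derivative at $v$ in the outward direction along $e$ (pointing from $v$ into $e$). The differential equation is understood in the distributional sense on the interior of each edge; then the flux $|w_{p,e}'|^{p-2}w_{p,e}'$ is an affine function on $e$, so its values at the endpoints, appearing in the vertex condition, are well defined. *)

(* Defs.v *)
From HB Require Import structures.
From mathcomp Require Import all_boot all_order all_algebra.
From mathcomp Require Import all_classical all_reals all_analysis.

Set Implicit Arguments.
Unset Strict Implicit.
Unset Printing Implicit Defensive.

Import Order.TTheory GRing.Theory Num.Theory.
Import numFieldNormedType.Exports.

Local Open Scope classical_set_scope.
Local Open Scope ring_scope.

Section Interval.
Variable R : realType.
Implicit Types (l p x : R) (u g phi : R -> R).

(* C_c^oo(0, l); since the support is closed and bounded, it is a compact
   subset of the open interval. *)
Definition test_function l phi : Prop :=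
  (forall n x, derivable (phi^`(n)%classic) x 1) /\
  closure [set x | phi x != 0] `<=` `]0, l[.

Definition weak_derivative l u g : Prop :=
  forall phi, test_function l phi ->
    \int[@lebesgue_measure R]_(x in `]0, l[) (u x * phi^`()%classic x) =
    - \int[@lebesgue_measure R]_(x in `]0, l[) (g x * phi x).

Definition in_Lp l p u : Prop :=
  measurable_fun `]0, l[ u /\
  (@lebesgue_measure R).-integrable `]0, l[ (fun x => (`|u x| `^ p)%:E).

Definition sobolev_W1p l p u : Prop :=
  in_Lp l p u /\ exists g, in_Lp l p g /\ weak_derivative l u g.

(* F is the (unique on [0, l]) continuous representative of f; it gives the
   meaning of the values of f at 0 and l. *)
Definition continuous_representative l (f F : R -> R) : Prop :=
  {within `[0, l], continuous F} /\
  {ae @lebesgue_measure R, forall x, `]0, l[%classic x -> f x = F x}.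

(* |g|^(p-2) g; where g vanishes this is 0, for every p, by the conventions
   of powR. *)
Definition p_flux p g x : R := `|g x| `^ (p - 2) * g x.

End Interval.

(* Loops and parallel edges are allowed; the orientation only serves to
   parametrize the edge e by [0, len e]. *)
Record metric_graph (R : realType) := MetricGraph {
  vertex : finType;
  edge : finType;
  source : edge -> vertex;
  target : edge -> vertex;
  len : edge -> R;
  len_gt0 : forall e, 0 < len e
}.

Section Graph.
Variables (R : realType) (G : metric_graph R).
Implicit Types (v : vertex G) (e : edge G).

(* (e, false) is the endpoint of e at 0, (e, true) the endpoint at len e;
   thus a loop contributes two elements. *)
Definition edge_end : finType := (edge G * bool)%type.

Definition end_vertex (h : edge_end) : vertex G :=
  if h.2 then target h.1 else source h.1.

Definition end_position (h : edge_end) : R := if h.2 then len h.1 else 0.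

Definition incident v : {set edge_end} := [set h | end_vertex h == v].

Definition degree v : nat := #|incident v|.

Definition adjacent : rel (vertex G) := fun v w =>
  [exists h : edge_end,
    (end_vertex h == v) && (end_vertex (h.1, ~~ h.2) == w)].

Definition connected_graph : Prop := forall v w, connect adjacent v w.

Inductive graph_point : Type :=
  | Vertex of vertex G
  | Interior (e : edge G) of {x : R | 0 < x < len e}.

(* The identification map [0, len e] -> G; reals outside [0, len e] are sent
   to the nearest endpoint. *)
Definition edge_point e (x : R) : graph_point :=
  if (insub x : option {y : R | 0 < y < len e}) is Some y then Interior y
  else if x <= 0 then Vertex (source e) else Vertex (target e).

Definition edge_restriction (u : graph_point -> R) e : R -> R :=
  fun x => u (edge_point e x).

(* Continuity of all u_e on the closed intervals, with endpoint values the
   values of u at the vertices, is continuity of u at the vertices together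
   with the choice of the continuous representative inside the edges. *)
Definition graph_W1p (p : R) (u : graph_point -> R) : Prop :=
  forall e, {within `[0, len e], continuous (edge_restriction u e)} /\
    sobolev_W1p (len e) p (edge_restriction u e).

Definition graph_W1p_dirichlet (p : R) (VD : {set vertex G})
    (u : graph_point -> R) : Prop :=
  graph_W1p p u /\ forall v, v \in VD -> u (Vertex v) = 0.

(* |w_e'(v)|^(p-2) d_nu w_e(v), where F e is the flux of w_e' along the
   parametrization of e. *)
Definition outward_flux (F : edge G -> R -> R) (h : edge_end) : R :=
  (if h.2 then -1 else 1) * F h.1 (end_position h).

(* dw e is the weak derivative of w on e, and F e is the continuous (in fact
   affine) version of the flux |dw e|^(p-2) dw e. *)
Definition p_torsion (p : R) (VD : {set vertex G})
    (w : graph_point -> R) : Prop :=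
  graph_W1p_dirichlet p VD w /\
  exists dw F : edge G -> R -> R,
    [/\ forall e, in_Lp (len e) p (dw e) /\
          weak_derivative (len e) (edge_restriction w e) (dw e),
        forall e, weak_derivative (len e)
          (fun x => - p_flux p (dw e) x) (fun=> 1),
        forall e, continuous_representative (len e) (p_flux p (dw e)) (F e) &
        forall v, v \notin VD ->
          \sum_(h in incident v) outward_flux F h = 0].

End Graph.

Arguments Vertex {R G}.
Arguments Interior {R G e}.

(* Main.v *)
Require Import Defs.
From mathcomp Require Import all_boot all_order all_algebra.
From mathcomp Require Import all_classical all_reals all_analysis.
From mathcomp Require Import measurable_realfun.
From mathcomp Require Import lra ring.

(* Let phi be the inverse of the flux map s |-> |s|^(p-2) s and Phi a primitive
   of phi. By the du Bois-Reymond lemma, the flux of a torsion function on an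
   edge of length l is a - x, hence w' = phi (a - x) and
   w x = w 0 + Phi a - Phi (a - x). The increment Phi a - Phi (a - l) of w is an
   increasing bijective function of a, with inverse A say; by the symmetry
   A (- d) = l - A d the outward flux at either end is A applied to the
   difference (value at the other end) - (value at this end). The torsion problem
   is thus a nonlinear Kirchhoff system for the vertex values whose edge
   responses are increasing. Its solution is the pointwise supremum of the
   subsolutions (Perron's method), and it is unique by the maximum principle. *)

Set Implicit Arguments.
Unset Strict Implicit.
Unset Printing Implicit Defensive.
Import Order.TTheory GRing.Theory Num.Theory.
Import numFieldNormedType.Exports.
Local Open Scope classical_set_scope.
Local Open Scope ring_scope.

(** * Nonlinear networks *)

Lemma connect_stable (T : finType) (e : rel T) (P : T -> Prop) x y :
  (forall a b, e a b -> P a -> P b) -> connect e x y -> P x -> P y.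
Proof.
move=> eP /connectP[s + ->]; elim: s x => //= z s IH x /andP[xz zs] Px.
exact: IH zs (eP _ _ xz Px).
Qed.

Section Network.
(** An element [h] of [H] is an edge directed from [tail h] to [head h], and [A h] gives the flux
    leaving the tail as a function of head value minus tail value. [A0] makes the zero function a
    subsolution; [A_coercive] keeps the head from lying far below the tail when the flux is bounded
    below. *)
Variables (R : realType) (V H : finType) (tail head : H -> V).
Variables (A : H -> R -> R) (D : {set V}).

Let adj : rel V := fun v w => [exists h, (tail h == v) && (head h == w)].

Hypothesis conn : forall v w, connect adj v w.
Hypothesis D0 : D != finset.set0.
Hypothesis A_lt : forall h, {homo A h : x y / x < y}.
Hypothesis A_cont : forall h, continuous (A h).
Hypothesis A0 : forall h, 0 <= A h 0.
Hypothesis A_coercive : forall h K, exists C, forall x, K <= A h x -> - C <= x.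

Definition divergence (U : V -> R) v : R :=
  \sum_(h | tail h == v) A h (U (head h) - U v).

Let A_le h : {homo A h : x y / x <= y}.
Proof. exact/ltW_homo/A_lt. Qed.

Lemma divergence_le (U W : V -> R) v :
  (forall w, U w <= W w) -> U v = W v -> divergence U v <= divergence W v.
Proof.
by move=> UW Uv; apply: ler_sum => h _; apply: A_le; rewrite Uv lerD2r.
Qed.

(** If [U - W] has a positive maximum at [a] outside [D], each flux of [U] out of [a] is at most
    that of [W], while the sums compare the other way. So all these fluxes agree, strict
    monotonicity makes every neighbour a maximum point, and by connectedness the maximum reaches
    [D], where it cannot be positive. *)
Lemma comparison (U W : V -> R) :
  (forall v, v \notin D -> 0 <= divergence U v) ->
  (forall v, v \notin D -> divergence W v <= 0) ->
  (forall v, v \in D -> U v <= W v) -> forall v, U v <= W v.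
Proof.
move=> subU supW UW v.
have [d dD] := set0Pn _ D0.
have [m _ /= mmax] := @Order.TotalTheory.arg_maxP _ _ _ d xpredT
  (fun v => U v - W v) isT.
have [m0|m0] := leP (U m - W m) 0.
  by rewrite -subr_le0; apply: le_trans m0; exact: mmax.
suff : U d - W d = U m - W m.
  by move=> dm; have := UW _ dD; rewrite -subr_le0 dm leNgt m0.
have /(@connect_stable _ adj (fun x => U x - W x = U m - W m)) := conn m d.
apply => // a b /existsP[h /andP[/eqP ta /eqP hb]] am.
have aD : a \notin D.
  by apply/negP => /UW; rewrite -subr_le0 am leNgt m0.
have le_h k : tail k == a -> A k (U (head k) - U a) <= A k (W (head k) - W a).
  move=> _; apply: A_le; move: (mmax (head k) isT); rewrite -am; lra.
have : \sum_(k | tail k == a)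
    (A k (W (head k) - W a) - A k (U (head k) - U a)) = 0.
  apply/eqP; rewrite eq_le sumr_ge0 ?andbT; last first.
    by move=> k /le_h; rewrite subr_ge0.
  rewrite sumrB subr_le0.
  exact: le_trans (supW _ aD) (subU _ aD).
have nn k : tail k == a -> 0 <= A k (W (head k) - W a) - A k (U (head k) - U a).
  by move=> /le_h; rewrite subr_ge0.
move=> /(psumr_eq0P nn) /(_ h); rewrite ta eqxx => /(_ isT)/eqP.
rewrite subr_eq0 hb => /eqP e.
have := mmax b isT; rewrite -am le_eqVlt => /orP[/eqP //|lt].
suff /(A_lt h) : U b - U a < W b - W a by rewrite e ltxx.
lra.
Qed.

Definition subsolution (U : V -> R) : Prop :=
  (forall v, v \in D -> U v <= 0) /\
  (forall v, v \notin D -> 0 <= divergence U v).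

Let subsolution0 : subsolution (fun=> 0).
Proof.
by split=> // v _; apply: sumr_ge0 => h _; rewrite subrr.
Qed.

(* If U is close to its maximum M at a, then no term of the divergence at a is
   large, so all of them are bounded below and U is close to M at every
   neighbour of a; this propagates to D, where U <= 0. *)
Lemma subsolution_max_bounded v : exists C, forall U, subsolution U ->
  (forall w, U w <= U v) -> U v <= C.
Proof.
pose near_max w := exists C, forall U, subsolution U ->
  (forall w, U w <= U v) -> U v <= C \/ U v - C <= U w.
have [d dD] := set0Pn _ D0.
suff : near_max d.
  move=> [C hC]; exists C => U sU Uv; have [//|] := hC _ sU Uv.
  by have := sU.1 _ dD; lra.
have /(@connect_stable _ adj near_max) := conn v d; apply; last first.
  by exists 0 => U sU Uv; right; rewrite subr0.
move=> a b /existsP[h /andP[/eqP ta /eqP hb]] [C hC].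
have [aD|aD] := boolP (a \in D).
  exists C => U sU Uv; left; have [//|] := hC _ sU Uv.
  by have := sU.1 _ aD; lra.
have [C' hC'] := A_coercive h (- \sum_(k | (tail k == a) && (k != h)) A k C).
exists (C + Num.max C' 0) => U sU Uv.
have C'0 : 0 <= Num.max C' 0 by rewrite le_max lexx orbT.
have C'C' : C' <= Num.max C' 0 by rewrite le_max lexx.
have [UC|Ua] := hC _ sU Uv; first by left; lra.
right; have := sU.2 _ aD; rewrite /divergence (bigD1 h) ?ta//= hb => div0.
suff /hC' : - \sum_(k | (tail k == a) && (k != h)) A k C <= A h (U b - U a).
  lra.
suff : \sum_(k | (tail k == a) && (k != h)) A k (U (head k) - U a) <=
       \sum_(k | (tail k == a) && (k != h)) A k C by lra.
apply: ler_sum => k _; apply: A_le; have := Uv (head k); lra.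
Qed.

Lemma subsolution_bounded : exists B, forall U, subsolution U ->
  forall v, U v <= B.
Proof.
have /choice[C hC] := subsolution_max_bounded.
(* The vertex at which [U] is maximal depends on [U]; this sum dominates the bounds for all vertices
   at once. *)
exists (\sum_v `|C v|) => U sU v.
have [m _ mmax] := @Order.TotalTheory.arg_maxP _ _ _ v xpredT U isT.
apply: le_trans (mmax v isT) _; apply: le_trans (hC m U sU _) _.
  by move=> w; exact: mmax.
apply: le_trans (ler_norm _) _.
by rewrite (bigD1 m)//= lerDl sumr_ge0.
Qed.

Let update (U : V -> R) v t : V -> R := fun w => if w == v then t else U w.

Let divergence_update_continuous U v :
  continuous (fun t => divergence (update U v t) v).
Proof.
apply: (@continuous_big R H +%R 0 _ (@add_continuous R)) => h _.
(* When [h] is a loop at [v], both of its end values move with [t] and its term is constant. *)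
rewrite /update eqxx; case: (head h == v) => t.
  by rewrite (_ : (fun t => _) = cst (A h 0)); [exact: cvg_cst|
    apply/funext => s; rewrite subrr].
apply: (continuous_comp (f := fun t => U (head h) - t)); last exact: A_cont.
by apply: cvgB; [exact: cvg_cst|exact: cvg_id].
Qed.

Let perron v : R := sup [set U v | U in subsolution].

Let perron_has_sup v : has_sup [set U v | U in subsolution].
Proof.
split; first by exists 0; exists (fun=> 0).
have [B hB] := subsolution_bounded.
by exists B => _ [U sU <-]; exact: hB.
Qed.

Let perron_ge U : subsolution U -> forall v, U v <= perron v.
Proof.
by move=> sU v; apply: sup_upper_bound => //; exists U.
Qed.

Let update_id U v : update U v (U v) = U.
Proof. by apply/funext => w; rewrite /update; case: eqP => // ->. Qed.

(** If the divergence were negative at [v], it would stay so after lowering the value at [v] to that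
    of a subsolution [U] nearly attaining the supremum there. But the lowered function dominates [U]
    and agrees with it at [v], so its divergence at [v] is nonnegative. *)
Let perron_sub : subsolution perron.
Proof.
split=> v vD.
  apply: ge_sup; first by exists 0; exists (fun=> 0).
  by move=> _ [U [sU _] <-]; exact: sU.
rewrite leNgt; apply/negP => neg.
have := @divergence_update_continuous perron v (perron v).
move=> /cvgrPdist_lt/(_ (- divergence perron v)).
rewrite oppr_gt0 update_id => /(_ neg)[/= e e0 he].
have [_ [U sU <-] ltU] := sup_adherent e0 (perron_has_sup v).
have := he (U v); rewrite /= ger0_norm ?subr_ge0 ?perron_ge//.
have -> : perron v - U v < e by rewrite ltrBlDr addrC -ltrBlDr.
move=> /(_ isT).
have : 0 <= divergence (update perron v (U v)) v.
  apply: le_trans (sU.2 _ vD) _; apply: divergence_le => [w|]; rewrite /update.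
    by case: eqP => [->//|_]; exact: perron_ge.
  by rewrite eqxx.
move=> ge0; rewrite ltr_norml => /andP[]; lra.
Qed.

Lemma network_solution : exists U : V -> R,
  (forall v, v \in D -> U v = 0) /\ (forall v, v \notin D -> divergence U v = 0).
Proof.
exists perron; split=> v vD.
  apply/eqP; rewrite eq_le perron_sub.1//=.
  exact: (perron_ge subsolution0).
apply/eqP; rewrite eq_le perron_sub.2// andbT leNgt; apply/negP => pos.
have := @divergence_update_continuous perron v (perron v).
move=> /cvgrPdist_lt/(_ (divergence perron v)).
rewrite update_id => /(_ pos)[/= e e0 he].
(* A positive divergence at [v] survives a small rise of the value at [v], and the rise can only
   increase the divergence elsewhere. So [W] would be a subsolution exceeding the supremum. *)
pose W := update perron v (perron v + e / 2).
have perronW w : perron w <= W w.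
  by rewrite /W /update; case: eqP => // ->; lra.
suff /perron_ge/(_ v) : subsolution W.
  by rewrite /W /update eqxx; lra.
split=> w wD.
  rewrite /W /update; case: eqP => [wv|_]; last exact: perron_sub.1.
  by rewrite -wv wD in vD.
have [wv|wv] := eqVneq w v; last first.
  apply: le_trans (perron_sub.2 _ wD) _; apply: divergence_le => //.
  by rewrite /W /update (negbTE wv).
have := he (perron v + e / 2); rewrite /= opprD addNKr normrN.
have -> : `|e / 2| < e by rewrite ger0_norm; lra.
move=> /(_ isT)/ltr_normlW; rewrite wv -/W; lra.
Qed.

End Network.

(** * Primitives, signed powers and edge conductances *)

Section RealFunctions.
Variable R : realType.
Local Notation mu := (@lebesgue_measure R).
Implicit Types (f g df : R -> R) (x : R).

Lemma is_derive_continuous f df :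
  (forall x, is_derive x (1 : R) f (df x)) -> continuous f.
Proof.
by move=> dF x; apply/differentiable_continuous/derivable1_diffP; case: (dF x).
Qed.

(** The points [g (f x - e)] and [g (f x + e)] enclose a neighbourhood of [x] that [f] maps to
    within [e] of [f x]. *)
Lemma homo_surj_continuous f g :
  {homo f : x y / x < y} -> cancel g f -> continuous f.
Proof.
move=> fm gK x; apply/cvgrPdist_lt => /= e e0.
have f_lt := leW_mono (le_mono fm).
near=> y; rewrite ltr_norml; apply/andP; split.
  rewrite ltrBrDr addrC -ltrBrDr opprK -[ltRHS]gK f_lt.
  by near: y; apply: lt_nbhsl; rewrite -f_lt gK; lra.
rewrite ltrBlDr addrC -ltrBlDr -[ltLHS]gK f_lt.
by near: y; apply: lt_nbhsr; rewrite -f_lt gK; lra.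
Unshelve. all: by end_near. Qed.

Lemma continuous_itv_integrable f (a b : R) : continuous f ->
  mu.-integrable `[a, b] (EFin \o f).
Proof.
move=> cf; apply: continuous_compact_integrable; first exact: segment_compact.
exact: continuous_subspaceT.
Qed.

Lemma continuous_primitive f : continuous f ->
  exists F : R -> R, forall x, is_derive x (1 : R) F (f x).
Proof.
move=> cf; pose I a x := \int[mu]_(t in `[a, x]) f t.
(* An integral over [[a, x]] carries no orientation, so the lower limit is put to the left of both
   [x] and 0; the difference of the two integrals does not depend on it. *)
pose base x : R := Num.min x 0 - 1.
have I_indep a b x : a <= b -> b <= x -> I a x - I a b = I b x.
  move=> ab bx; rewrite /I Rintegral_itvB//; last first.
    exact: continuous_itv_integrable.
  rewrite Rintegral_itv_obnd_cbnd//.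
  by apply: integrableS (continuous_itv_integrable b x cf) => //;
    exact: subset_itv_oc_cc.
have base0 x : base x <= 0 by rewrite /base; case: (leP x 0); lra.
have basex x : base x <= x by rewrite /base; case: (leP x 0); lra.
exists (fun x => I (base x) x - I (base x) 0) => x.
(* This one lower limit serves all [y > x - 1], so near [x] the primitive is [I a] minus a
   constant. *)
pose a := base x - 1.
have aE y : x - 1 < y ->
    I a y - I a 0 = I (base y) y - I (base y) 0.
  move=> xy; have ay : a <= base y.
    by rewrite /a /base; case: (leP x 0); case: (leP y 0); lra.
  by rewrite -!(I_indep a (base y)) ?base0 ?basex//; lra.
apply: (@near_eq_is_derive _ _ _ (fun y => I a y - I a 0)).
  by near=> y; apply: aE; near: y; apply: lt_nbhsr; lra.
rewrite -[f x]subr0.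
have ax : a < x by rewrite /a; have := basex x; lra.
have x1 : x < x + 1 by rewrite ltrDl.
have [dI dIE] := @continuous_FTC1_closed R f a x (x + 1) x1
  (continuous_itv_integrable _ _ cf) ax (cf x).
apply: is_deriveB; rewrite -dIE derive1E; exact: DeriveDef.
Unshelve. all: by end_near. Qed.

End RealFunctions.

Section SignedPower.
Variable R : realType.
Implicit Types r s x y : R.

(** The signed power. Exponent [p - 1] gives the flux map, and its inverse is the signed power with
    exponent [(p - 1)^-1]. *)
Definition spow r x := Num.sg x * `|x| `^ r.

Lemma spowN r x : spow r (- x) = - spow r x.
Proof. by rewrite /spow sgrN normrN mulNr. Qed.

Lemma spowK r s : 0 < r -> r * s = 1 -> cancel (spow r) (spow s).
Proof.
move=> r0 rs1 x; rewrite /spow.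
have [->|x0] := eqVneq x 0; first by rewrite sgr0 mul0r sgr0 mul0r.
have xr0 : 0 < `|x| `^ r by rewrite powR_gt0// normr_gt0.
rewrite sgrM sgr_id (gtr0_sg xr0) mulr1 normrM normr_sg x0 mul1r.
by rewrite (gtr0_norm xr0) -powRrM rs1 powRr1// -numEsg.
Qed.

Lemma spow_homo r : 0 < r -> {homo spow r : x y / x < y}.
Proof.
move=> r0; have pos x y : 0 <= x -> x < y -> spow r x < spow r y.
  move=> x0 xy; have y0 := le_lt_trans x0 xy.
  rewrite /spow (gtr0_sg y0) mul1r (gtr0_norm y0) (ger0_norm x0).
  have : x `^ r < y `^ r by apply: gt0_ltr_powR; rewrite ?nnegrE// ltW.
  have [->|x1] := eqVneq x 0; first by rewrite sgr0 mul0r powR_gt0.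
  by rewrite gtr0_sg ?lt_def ?x1// mul1r.
move=> x y xy; have [x0|x0] := leP 0 x; first exact: pos.
have [y0|y0] := leP y 0.
  by rewrite -ltrN2 -!spowN; apply: pos; lra.
apply: (@lt_trans _ _ (spow r 0)); last exact: pos.
by rewrite -ltrN2 -!spowN oppr0; apply: pos; lra.
Qed.

Lemma p_flux_spow (p : R) (g : R -> R) x : 1 < p ->
  p_flux p g x = spow (p - 1) (g x).
Proof.
move=> p1; rewrite /p_flux /spow; have p0 : 0 < p - 1 by lra.
rewrite {2}(numEsg (g x)) mulrCA [_ `^ _ * _]mulrC; congr (_ * _).
by rewrite -(mulr_powRB1 _ p0)//; congr (_ * _ `^ _); lra.
Qed.

End SignedPower.

(* The hypotheses hold for phi = spow (p - 1)^-1 and psi = spow (p - 1). With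
   the flux a - x on [0, l], the torsion function increases by
   Phi a - Phi (a - l) along the edge; the map A below recovers a from this
   increment. *)
Section Conductance.
Variables (R : realType) (phi psi Phi : R -> R).
Hypothesis phi_homo : {homo phi : x y / x < y}.
Hypothesis psiK : cancel psi phi.
Hypothesis phiN : forall x, phi (- x) = - phi x.
Hypothesis dPhi : forall x : R, is_derive x (1 : R) Phi (phi x).

(** Since [phi] is odd, [Phi (- x) - Phi x] has derivative zero, and it vanishes at 0. *)
Lemma primitive_even x : Phi (- x) = Phi x.
Proof.
suff : Phi (- x) - Phi x = Phi (- 0) - Phi 0.
  by rewrite oppr0 subrr => /eqP; rewrite subr_eq0 => /eqP.
apply: (@is_derive_0_is_cst _ (fun x => Phi (- x) - Phi x)) => y.
rewrite -[X in is_derive _ _ _ X](_ : phi (- y) * (-1) - phi y = 0); last first.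
  by rewrite phiN; ring.
by apply: is_deriveB; apply: (@is_derive1_comp _ Phi -%R).
Qed.

(** The increment [drop] has the positive derivative [phi a - phi (a - l)], is odd about [l / 2]
    because [Phi] is even, and is onto because it lies between [l * phi (a - l)] and [l * phi a].
    [A] is its inverse. *)
Lemma edge_conductance (l : R) : 0 < l -> exists A : R -> R,
  [/\ {homo A : x y / x < y}, continuous A,
      forall d, Phi (A d) - Phi (A d - l) = d,
      forall a, A (Phi a - Phi (a - l)) = a &
      forall d, A (- d) = l - A d].
Proof.
move=> l0; pose drop a := Phi a - Phi (a - l).
have cPhi := is_derive_continuous dPhi.
have ddrop (a : R) : is_derive a (1 : R) drop (phi a - phi (a - l)).
  apply: is_deriveB; rewrite -[phi _]mulr1.
  apply: (@is_derive1_comp _ Phi (fun a => a - l)).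
  by rewrite -[X in is_derive _ _ _ X]subr0; apply: is_deriveB.
have cdrop := is_derive_continuous ddrop.
have drop_homo : {homo drop : x y / x < y}.
  move=> a b ab; rewrite -subr_gt0.
  have [c _ ->] := MVT ab (fun x _ => ddrop x) (continuous_subspaceT cdrop).
  by rewrite mulr_gt0 ?subr_gt0// phi_homo// ltrBlDr ltrDl.
have dropN a : drop (l - a) = - drop a.
  by rewrite /drop -primitive_even opprB addrAC subrr sub0r primitive_even opprB.
have drop_ge a : l * phi (a - l) <= drop a <= l * phi a.
  have al : a - l < a by rewrite ltrBlDr ltrDl.
  have [c] := MVT al (fun x _ => dPhi x) (continuous_subspaceT cPhi).
  rewrite /drop in_itv/= => /andP[ac ca] ->; rewrite opprB addrCA subrr addr0.
  by rewrite (mulrC (phi c)) !ler_pM2l// !ltW//; apply: phi_homo.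
have drop_surj y : exists a, drop a = y.
  (* The arguments are chosen through [psi] so that the bounds of [drop_ge] become exactly [|y|] and
     [-|y|]. *)
  have hi : `|y| <= drop (psi (`|y| / l) + l).
    apply: le_trans (proj1 (andP (drop_ge _))).
    by rewrite addrK psiK mulrC divfK ?gt_eqF.
  have lo : drop (psi (- `|y| / l)) <= - `|y|.
    apply: le_trans (proj2 (andP (drop_ge _))) _.
    by rewrite psiK mulrC divfK ?gt_eqF.
  have lohi : psi (- `|y| / l) <= psi (`|y| / l) + l.
    rewrite leNgt; apply/negP => /drop_homo/lt_le_trans/(_ lo).
    by move/(le_lt_trans hi); have := normr_ge0 y; lra.
  have [|a _ <-] := IVT (v := y) lohi (continuous_subspaceT cdrop).
    have := ler_norm y; have := lerNnormlW (lexx `|y|).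
    by rewrite ge_min le_max => ? ?; apply/andP; split; apply/orP; [left|right]; lra.
  by exists a.
have [A AK] := choice drop_surj.
have drop_lt := leW_mono (le_mono drop_homo).
have A_homo : {homo A : x y / x < y} by move=> x y xy; rewrite -drop_lt !AK.
have drop_inj : injective drop := inc_inj (le_mono drop_homo).
have dropK : cancel drop A by move=> a; apply: drop_inj; rewrite AK.
exists A; split=> //; first exact: homo_surj_continuous A_homo dropK.
by move=> d; apply: drop_inj; rewrite dropN !AK.
Qed.

End Conductance.

(** * Smooth steps *)

Section Bump.
Variable R : realType.
Implicit Types (f g df dg : R -> R) (x a c : R).

(** For [k = 0] this is the classical smooth function that is flat at 0; the negative powers of [x]
    are those that appear when it is differentiated. *)
Definition flat k x : R := if 0 < x then x^-1 ^+ k * expR (- x^-1) else 0.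

(** One term of the exponential series at [x^-1], of degree [k + 2], absorbs [x^-1 ^+ k] and leaves
    a factor [x ^+ 2]. A quadratic bound is what gives derivative 0 at the origin. *)
Lemma flat_bound k : exists C, forall x, `|flat k x| <= C * x ^+ 2.
Proof.
exists ((k.+2)`!%:R) => x; rewrite /flat; case: ifPn => [x0|_]; last first.
  by rewrite normr0 mulr_ge0// sqr_ge0.
have y0 : 0 < x^-1 by rewrite invr_gt0.
rewrite ger0_norm; last by rewrite mulr_ge0 ?expR_ge0// exprn_ge0// ltW.
rewrite expRN ler_pdivrMr ?expR_gt0//.
have := expR_ge1Dxn k.+1 (ltW y0).
have f0 : 0 < (k.+2)`!%:R :> R by rewrite ltr0n fact_gt0.
move=> ge1; have {}ge1 : x^-1 ^+ k.+2 / (k.+2)`!%:R <= expR x^-1.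
  by apply: le_trans ge1; rewrite lerDr.
rewrite ler_pdivrMr// in ge1.
have -> : x^-1 ^+ k = x^-1 ^+ k.+2 * x ^+ 2.
  by rewrite -addn2 exprD -mulrA -exprMn mulVf ?gt_eqF// expr1n mulr1.
by rewrite [leRHS]mulrAC ler_wpM2r ?sqr_ge0// mulrC.
Qed.

Lemma is_derive_quadratic f (C : R) : (forall x, `|f x| <= C * x ^+ 2) ->
  is_derive (0 : R) (1 : R) f 0.
Proof.
move=> fC; have f0 : f 0 = 0.
  by apply/normr0_eq0/le_anti; rewrite normr_ge0 andbT (le_trans (fC 0))// expr0n mulr0.
have cv : h^-1 *: ((f \o shift 0) (h *: (1 : R)) - f 0) @[h --> (0 : R)^'] --> (0 : R).
  apply/cvgrPdist_lt => /= e e0; have C1 : 0 < `|C| + 1 by rewrite ltr_wpDl.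
  near=> h; rewrite sub0r normrN f0 subr0 addr0 normrM [_ *: _]mulr1.
  have h0 : h != 0 by near: h; exact: nbhs_dnbhs_neq.
  rewrite normfV mulrC ltr_pdivrMr ?normr_gt0//.
  apply: le_lt_trans (fC h) _; rewrite -[h ^+ 2]ger0_norm ?sqr_ge0// normrX expr2 mulrA.
  rewrite ltr_pM2r ?normr_gt0//.
  apply: (@le_lt_trans _ _ ((`|C| + 1) * `|h|)).
    by rewrite ler_wpM2r// (le_trans (ler_norm C))// lerDl.
  rewrite mulrC -ltr_pdivlMr//; near: h; apply: dnbhs0_lt; exact: divr_gt0.
by apply: DeriveDef; [exact/cvgP/cv|exact/cvg_lim].
Unshelve. all: by end_near. Qed.

Lemma is_derive_flat k x :
  is_derive x (1 : R) (flat k) (flat k.+2 x - k%:R * flat k.+1 x).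
Proof.
have [x0|x0|->] := ltgtP x 0.
- rewrite /flat ltNge ltW//= mulr0 subr0.
  apply: (@near_eq_is_derive _ _ _ (cst 0)) => //.
  near=> y; rewrite /flat ltNge ltW//=; near: y; exact: lt_nbhsl.
- apply: (@near_eq_is_derive R R R (fun y : R => y^-1 ^+ k * expR (- y^-1))).
    near=> y; rewrite /flat ifT//; near: y; exact: lt_nbhsr.
  rewrite /flat x0.
  have dV : is_derive x (1 : R) (fun y : R => y^-1) (- x ^- 2).
    by rewrite -[- _]mulr1; apply: is_deriveV; rewrite gt_eqF.
  have dX : is_derive x (1 : R) (fun y : R => y^-1 ^+ k) (- (k%:R * x^-1 ^+ k.+1)).
    have := is_deriveX k dV; rewrite exprfctE => /is_derive_eq; apply.
    case: k => [|k] /=; first by rewrite !mul0r oppr0 scale0r.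
    rewrite /GRing.scale/= mulrN -mulrA; congr (- (_ * _)).
    by rewrite -exprVn -exprD addn2.
  have dE : is_derive x (1 : R) (fun y : R => expR (- y^-1)) (expR (- x^-1) * x^-1 ^+ 2).
    apply: (@is_derive1_comp _ expR (fun y => - y^-1)).
    rewrite -[X in is_derive _ _ _ X]opprK exprVn; exact: is_deriveN.
  apply: is_derive_eq (is_deriveM dX dE) _.
  rewrite /GRing.scale/= -[k.+2]addn2 exprD; ring.
- rewrite /flat ltxx mulr0 subr0; have [C hC] := flat_bound k.
  exact: is_derive_quadratic hC.
Unshelve. all: by end_near. Qed.

(** A class closed under differentiation, so all its members are smooth. [BumpPrimitive] adds
    primitives, which have no closed form but are needed for the smooth steps. *)
Inductive bump_class : (R -> R) -> Prop :=
  | BumpFlat k s a : bump_class (fun x => flat k (s * x + a))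
  | BumpCst a : bump_class (cst a)
  | BumpD f g : bump_class f -> bump_class g -> bump_class (f + g)
  | BumpM f g : bump_class f -> bump_class g -> bump_class (f * g)
  | BumpPrimitive f df : (forall x, is_derive x (1 : R) f (df x)) ->
      bump_class df -> bump_class f.

Lemma bump_class_derive f : bump_class f ->
  exists2 df, bump_class df & forall x, is_derive x (1 : R) f (df x).
Proof.
elim=> [k s a|a|{}f g _ [df Cdf fdf] _ [dg Cdg gdg]|
  {}f g Cf [df Cdf fdf] Cg [dg Cdg gdg]|{}f df fdf Cdf _].
- exists ((fun x => flat k.+2 (s * x + a)) * cst s +
          cst (- k%:R * s) * (fun x => flat k.+1 (s * x + a))) => [|x].
    by apply: BumpD; apply: BumpM; constructor.
  rewrite [X in is_derive _ _ _ X](_ : _ =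
    (flat k.+2 (s * x + a) - k%:R * flat k.+1 (s * x + a)) * s); last first.
    by rewrite /cst !fctE /=; ring.
  apply: (@is_derive1_comp _ (flat k) (fun x => s * x + a)).
    exact: is_derive_flat.
  rewrite -[X in is_derive _ _ _ X]addr0; apply: is_deriveD.
  by rewrite -[X in is_derive _ _ _ X]mulr1; apply: (@is_deriveZ _ _ _ id).
- by exists (cst 0) => [|x]; [exact: BumpCst|exact: is_derive_cst].
- by exists (df + dg) => [|x]; [exact: BumpD|exact: is_deriveD].
- exists (f * dg + g * df) => [|x]; first by apply: BumpD; exact: BumpM.
  exact: is_deriveM.
- by exists df.
Qed.

Lemma bump_class_smooth f : bump_class f ->
  forall n x, derivable (f^`(n)%classic) x 1.
Proof.
move=> Cf; have Cn n : bump_class (f^`(n)%classic).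
  elim: n => // n /bump_class_derive[df Cdf fdf]; rewrite derive1nS.
  suff -> : derive1 (f^`(n)%classic) = df by [].
  by apply/funext => x; rewrite derive1E; case: (fdf x).
move=> n x; have [df _ fdf] := bump_class_derive (Cn n).
by case: (fdf x).
Qed.

(** The step is the primitive, normalised to go from 0 to 1, of a bump that is positive exactly on
    []a, c[]. *)
Lemma smooth_step a c : a < c -> exists2 t : R -> R, bump_class t &
  [/\ forall x, x <= a -> t x = 0, forall x, c <= x -> t x = 1 &
      exists dt : R -> R, [/\ forall x, is_derive x (1 : R) t (dt x), continuous dt,
        forall x, 0 <= dt x & forall x, ~~ (a < x < c) -> dt x = 0]].
Proof.
move=> ac.
pose b := (fun x => flat 0 (1 * x + - a)) * (fun x => flat 0 (-1 * x + c)).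
have Cb : bump_class b by apply: BumpM; exact: BumpFlat.
have bE x : b x = flat 0 (x - a) * flat 0 (c - x).
  by rewrite /b fctE mul1r mulN1r [- x + c]addrC.
have flat_ge0 x : 0 <= flat 0 x.
  by rewrite /flat; case: ifP => // _; rewrite expr0 mul1r expR_ge0.
have flat_gt0 x : 0 < x -> 0 < flat 0 x.
  by rewrite /flat => ->; rewrite expr0 mul1r expR_gt0.
have b_ge0 x : 0 <= b x by rewrite bE mulr_ge0.
have b_out x : ~~ (a < x < c) -> b x = 0.
  rewrite negb_and => /orP[nax|ncx]; rewrite bE /flat !subr_gt0.
    by rewrite (negbTE nax) mul0r.
  by rewrite (negbTE ncx) mulr0.
have [db _ bdb] := bump_class_derive Cb.
have cb : continuous b := is_derive_continuous bdb.
have [B dB] := continuous_primitive cb.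
have cB := is_derive_continuous dB.
have B_left x : x <= a -> B x = B a.
  move=> xa; apply/esym/eqP; rewrite -subr_eq0.
  have [z] := MVT_segment xa (fun z _ => dB z) (continuous_subspaceT cB).
  by rewrite in_itv/= => /andP[_ za] ->; rewrite b_out ?mul0r// ltNge za.
have B_right x : c <= x -> B x = B c.
  move=> cx; apply/eqP; rewrite -subr_eq0.
  have [z] := MVT_segment cx (fun z _ => dB z) (continuous_subspaceT cB).
  by rewrite in_itv/= => /andP[cz _] ->; rewrite b_out ?mul0r// negb_and -!leNgt cz orbT.
have m0 : 0 < B c - B a.
  have [z] := MVT ac (fun z _ => dB z) (continuous_subspaceT cB).
  rewrite in_itv/= => /andP[az zc] ->.
  by rewrite mulr_gt0 ?subr_gt0// bE mulr_gt0// flat_gt0// subr_gt0.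
pose m := (B c - B a)^-1.
exists ((B + cst (- B a)) * cst m).
  apply: BumpM; last exact: BumpCst.
  by apply: BumpD; [exact: BumpPrimitive dB Cb|exact: BumpCst].
split=> [x /B_left xa|x /B_right cx|].
- by rewrite !fctE /= xa subrr mul0r.
- by rewrite !fctE /= cx /m mulfV// gt_eqF.
exists (fun x => b x * m); split=> [x|x|x|x /b_out ->].
- have := @is_deriveM _ _ (B + cst (- B a)) (cst m) x 1 (b x) 0 _ _.
  move/(_ _ _)/is_derive_eq; apply; last first.
    by rewrite scaler0 add0r /cst /GRing.scale/= mulrC.
  by rewrite -[b x]addr0; apply: is_deriveD.
- by apply: cvgM; [exact: cb|exact: cvg_cst].
- by rewrite mulr_ge0// invr_ge0 ltW.
- by rewrite mul0r.
Qed.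

End Bump.

(** * Weak derivatives on an interval *)

Section WeakDerivative.
Variable R : realType.
Local Notation mu := (@lebesgue_measure R).
Implicit Types (u g f F phi : R -> R) (l : R).

Lemma within_segment_integrable (a b : R) f : {within `[a, b], continuous f} ->
  mu.-integrable `[a, b] (EFin \o f).
Proof. by move=> cf; apply: continuous_compact_integrable => //; exact: segment_compact. Qed.

Lemma within_segment_integrable_oo (a b : R) f :
  {within `[a, b], continuous f} -> mu.-integrable `]a, b[ (EFin \o f).
Proof.
move=> /within_segment_integrable; apply: integrableS => //.
exact: subset_itv_oo_cc.
Qed.

Lemma Rintegral_itv_oo_cc (a b : R) f : mu.-integrable `[a, b] (EFin \o f) ->
  \int[mu]_(x in `]a, b[) f x = \int[mu]_(x in `[a, b]) f x.
Proof.
move=> intf; rewrite Rintegral_itv_bndo_bndc; last first.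
  by apply: integrableS intf => //; exact: subset_itv_oo_cc.
rewrite Rintegral_itv_obnd_cbnd//.
by apply: integrableS intf => //; exact: subset_itv_oc_cc.
Qed.

Lemma derivable_oo_LRcontinuousT (a b : R) F f :
  (forall x, is_derive x (1 : R) F (f x)) -> derivable_oo_LRcontinuous F a b.
Proof.
move=> dF; have cF := is_derive_continuous dF; split.
- by move=> x _; case: (dF x).
- exact/cvg_at_right_filter/cF.
- exact/cvg_at_left_filter/cF.
Qed.

Lemma Rintegral_derive (a b : R) F f : a < b ->
  (forall x, is_derive x (1 : R) F (f x)) -> continuous f ->
  \int[mu]_(x in `]a, b[) f x = F b - F a.
Proof.
move=> ab dF cf; rewrite Rintegral_itv_oo_cc; last exact: continuous_itv_integrable.
rewrite /Rintegral (@continuous_FTC2 _ f F)//.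
- exact: continuous_subspaceT.
- exact: derivable_oo_LRcontinuousT dF.
- by move=> x _; rewrite derive1E; case: (dF x).
Qed.

Lemma test_function_derive l phi : test_function l phi ->
  (forall x, is_derive x (1 : R) phi (derive1 phi x)) /\ continuous (derive1 phi).
Proof.
move=> [sphi _]; split=> [x|x].
  by rewrite derive1E; apply: DeriveDef => //; exact: (sphi 0%N x).
by apply/differentiable_continuous/derivable1_diffP; exact: (sphi 1%N x).
Qed.

Lemma test_function_out l phi x : test_function l phi ->
  ~~ (0 < x < l) -> phi x = 0.
Proof.
move=> [_ supp] xl; apply/eqP; apply: contraNT xl => phix.
have /supp : closure [set x | phi x != 0] x by exact: subset_closure.
by rewrite /= in_itv.
Qed.

(** Integration by parts; the boundary terms vanish because a test function is 0 at both ends. *)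
Lemma weak_derivative_C1 l u g : 0 < l ->
  (forall x, is_derive x (1 : R) u (g x)) -> continuous g ->
  weak_derivative l u g.
Proof.
move=> l0 du cg phi tphi; have [dphi cphi'] := test_function_derive tphi.
have cu := is_derive_continuous du; have cphi := is_derive_continuous dphi.
rewrite !Rintegral_itv_oo_cc; first last.
- by apply: continuous_itv_integrable => x; apply: cvgM; [exact: cu|exact: cphi'].
- by apply: continuous_itv_integrable => x; apply: cvgM; [exact: cg|exact: cphi].
rewrite (@Rintegration_by_parts _ u phi g)//.
- by rewrite !(test_function_out tphi) ?ltxx ?andbF// !mulr0 subrr sub0r.
- exact: continuous_subspaceT.
- exact: derivable_oo_LRcontinuousT du.
- by move=> x _; rewrite derive1E; case: (du x).
- exact: continuous_subspaceT.
- exact: derivable_oo_LRcontinuousT dphi.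
Qed.

Lemma eq_weak_derivative l u u' g g' :
  {in `]0, l[, u =1 u'} -> {in `]0, l[, g =1 g'} ->
  weak_derivative l u g -> weak_derivative l u' g'.
Proof.
move=> uu gg wd phi tphi; have := wd phi tphi.
rewrite (@eq_Rintegral _ _ _ mu `]0, l[ (fun x => u' x * derive1 phi x)); last first.
  by move=> x; rewrite inE/= => xl; rewrite uu.
rewrite [X in _ = - X -> _](@eq_Rintegral _ _ _ mu `]0, l[ (fun x => g' x * phi x))//.
by move=> x; rewrite inE/= => xl; rewrite gg.
Qed.

Lemma ae_eq_weak_derivative l u u' g g' :
  measurable_fun `]0, l[ u -> measurable_fun `]0, l[ u' ->
  measurable_fun `]0, l[ g -> measurable_fun `]0, l[ g' ->
  {ae mu, forall x, `]0, l[%classic x -> u x = u' x} ->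
  {ae mu, forall x, `]0, l[%classic x -> g x = g' x} ->
  weak_derivative l u g -> weak_derivative l u' g'.
Proof.
move=> mu1 mu2 mg1 mg2 uu gg wd phi tphi; have := wd phi tphi.
have [dphi cphi'] := test_function_derive tphi.
have cphi := is_derive_continuous dphi.
have mphi : measurable_fun `]0, l[ phi.
  apply: measurable_funS (continuous_measurable_fun cphi) => //.
have mphi' : measurable_fun `]0, l[ (derive1 phi).
  apply: measurable_funS (continuous_measurable_fun cphi') => //.
rewrite /Rintegral.
rewrite (@ae_eq_integral _ _ _ mu `]0, l[ (fun x => (u x * derive1 phi x)%:E)
  (fun x => (u' x * derive1 phi x)%:E))//; last 3 first.
- by apply/measurable_EFinP/measurable_funM.
- by apply/measurable_EFinP/measurable_funM.
- by apply: (filterS (Filter := ae_filter_ringOfSetsType mu) _ uu) => x /= h xl; rewrite h.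
rewrite (@ae_eq_integral _ _ _ mu `]0, l[ (fun x => (g x * phi x)%:E)
  (fun x => (g' x * phi x)%:E))//.
- by apply/measurable_EFinP/measurable_funM.
- by apply/measurable_EFinP/measurable_funM.
- by apply: (filterS (Filter := ae_filter_ringOfSetsType mu) _ gg) => x /= h xl; rewrite h.
Qed.

(** As [x] may be an endpoint, the segment is taken beside [x], towards the farther end of the
    interval, to stay inside []0, l[]. *)
Lemma within_segment_near l (G : R -> R) x (e : R) : 0 < l -> 0 < e ->
  {within `[0, l], continuous G} -> 0 <= x <= l ->
  exists a c, [/\ 0 < a, a < c, c < l &
    forall z, a <= z <= c -> `|G z - G x| < e].
Proof.
move=> l0 e0 cG /andP[x0 xl].
have xin : (`[0, l]%classic : set R) x by rewrite /= in_itv/= x0.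
move/subspace_continuousP : cG => /(_ x xin)/cvgrPdist_lt/(_ e e0).
rewrite near_withinE => -[/= d d0 hd].
have near_x z : `|x - z| < d -> 0 <= z <= l -> `|G z - G x| < e.
  by move=> zd zl; rewrite distrC; apply: hd => //=; rewrite in_itv.
pose m := Num.min d l / 4.
have m0 : 0 < m by rewrite divr_gt0// lt_min d0.
have md : m * 4 <= d by rewrite divfK// ge_min lexx.
have ml : m * 4 <= l by rewrite divfK// ge_min lexx orbT.
have [xl2|xl2] := leP x (l / 2).
  exists (x + m / 3), (x + m); split; try lra.
  move=> z /andP[az zc]; apply: near_x; last by apply/andP; split; lra.
  by rewrite ltr_norml; apply/andP; split; lra.
exists (x - m), (x - m / 3); split; try lra.
move=> z /andP[az zc]; apply: near_x; last by apply/andP; split; lra.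
by rewrite ltr_norml; apply/andP; split; lra.
Qed.

(** A single step is not compactly supported, but two steps cancel to the left of both (0 - 0) and
    to the right of both (1 - 1). *)
Lemma step_test_function l t1 t2 a1 c1 a2 c2 :
  0 < a1 -> c1 < l -> 0 < a2 -> c2 < l -> bump_class t1 -> bump_class t2 ->
  (forall x, x <= a1 -> t1 x = 0) -> (forall x, c1 <= x -> t1 x = 1) ->
  (forall x, x <= a2 -> t2 x = 0) -> (forall x, c2 <= x -> t2 x = 1) ->
  test_function l (fun x => t1 x - t2 x).
Proof.
move=> a10 c1l a20 c2l Ct1 Ct2 t1a t1c t2a t2c; split.
  apply: bump_class_smooth.
  have -> : (fun x => t1 x - t2 x) = t1 + cst (-1) * t2.
    by apply/funext => x; rewrite !fctE mulN1r.
  by apply: BumpD => //; apply: BumpM => //; exact: BumpCst.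
apply: (@subset_trans _ `[Num.min a1 a2, Num.max c1 c2]%classic); last first.
  move=> x /=; rewrite !in_itv/= => /andP[ax xc].
  by rewrite (lt_le_trans _ ax) ?lt_min ?a10// (le_lt_trans xc)// gt_max c1l.
rewrite (closure_id `[_, _]%classic).1; last exact: itv_closed.
apply: closure_subset => x /=; rewrite in_itv/=; apply: contraNT.
rewrite negb_and -!ltNge lt_min gt_max => /orP[/andP[xa1 xa2]|/andP[xc1 xc2]].
  by rewrite t1a ?t2a ?subrr// ltW.
by rewrite t1c ?t2c ?subrr// ltW.
Qed.

(* Test G against the difference of two smooth steps, whose derivatives are
   unit masses concentrated near x and near y. *)
Lemma du_bois_reymond l (G : R -> R) : 0 < l ->
  {within `[0, l], continuous G} ->
  (forall phi, test_function l phi ->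
    \int[mu]_(x in `]0, l[) (G x * derive1 phi x) = 0) ->
  forall x y, 0 <= x <= l -> 0 <= y <= l -> G x = G y.
Proof.
move=> l0 cG intG.
have le x y : 0 <= x <= l -> 0 <= y <= l -> G y <= G x.
  move=> xl yl; rewrite leNgt; apply/negP => xy.
  (* With a third of the gap, the two averages, at most [G x + e] and at least [G y - e], cannot be
     equal. *)
  pose e := (G y - G x) / 3; have e0 : 0 < e by rewrite divr_gt0// subr_gt0.
  have [a1 [c1 [a10 ac1 c1l near1]]] := within_segment_near l0 e0 cG xl.
  have [a2 [c2 [a20 ac2 c2l near2]]] := within_segment_near l0 e0 cG yl.
  have [t1 Ct1 [t1a t1c [dt1 [dt1E cdt1 dt1_ge0 dt1_out]]]] := smooth_step ac1.
  have [t2 Ct2 [t2a t2c [dt2 [dt2E cdt2 dt2_ge0 dt2_out]]]] := smooth_step ac2.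
  have := intG _ (step_test_function a10 c1l a20 c2l Ct1 Ct2 t1a t1c t2a t2c).
  have intGd (f : R -> R) : continuous f ->
      mu.-integrable `]0, l[ (EFin \o (fun x => G x * f x)).
    move=> cf; apply: within_segment_integrable_oo => z.
    apply: cvgM; first exact: cG.
    exact: (continuous_subspaceT cf).
  have intd (r : R) (f : R -> R) : continuous f ->
      mu.-integrable `]0, l[ (EFin \o (fun x => r * f x)).
    move=> cf; apply: within_segment_integrable_oo; apply: continuous_subspaceT.
    by move=> z; apply: cvgM; [exact: cvg_cst|exact: cf].
  have mass (r : R) (t dt : R -> R) : (forall x, is_derive x (1 : R) t (dt x)) ->
      continuous dt -> t 0 = 0 -> t l = 1 ->
      \int[mu]_(x in `]0, l[) (r * dt x) = r.
    move=> dtE cdt t0 tl; rewrite RintegralZl//.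
      by rewrite (Rintegral_derive l0 dtE cdt) t0 tl subr0 mulr1.
    have := intd 1 dt cdt; congr (integrable _ _ _).
    by apply/funext => z /=; rewrite mul1r.
  have -> : derive1 (fun z => t1 z - t2 z) = (fun z => dt1 z - dt2 z).
    apply/funext => z; rewrite derive1E.
    by have [] := is_deriveB (dt1E z) (dt2E z).
  under eq_Rintegral do rewrite mulrBr.
  rewrite RintegralB//; [|exact: intGd..].
  have : \int[mu]_(z in `]0, l[) (G z * dt1 z) <= G x + e.
    rewrite -[leRHS](mass _ t1 dt1)//; [|by rewrite t1a// ltW|by rewrite t1c// ltW].
    apply: le_Rintegral => //; [exact: intGd|exact: intd|move=> z _].
    have [zin|/dt1_out ->] := boolP (a1 < z < c1); last by rewrite !mulr0.
    apply: ler_wpM2r => //; case/andP: zin => az zc.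
    by have := near1 z; rewrite (ltW az) (ltW zc) => /(_ isT)/ltr_normlW; lra.
  have : G y - e <= \int[mu]_(z in `]0, l[) (G z * dt2 z).
    rewrite -[leLHS](mass _ t2 dt2)//; [|by rewrite t2a// ltW|by rewrite t2c// ltW].
    apply: le_Rintegral => //; [exact: intd|exact: intGd|move=> z _].
    have [zin|/dt2_out ->] := boolP (a2 < z < c2); last by rewrite !mulr0.
    apply: ler_wpM2r => //; case/andP: zin => az zc.
    have := near2 z; rewrite (ltW az) (ltW zc) => /(_ isT).
    by rewrite ltr_norml => /andP[]; lra.
  rewrite /e; lra.
by move=> x y xl yl; apply/le_anti; rewrite !le.
Qed.

(** Both [u] and the classical primitive [P] have weak derivative [g], so their difference is
    constant by [du_bois_reymond]. *)
Lemma weak_derivative_rigid l u g P : 0 < l ->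
  {within `[0, l], continuous u} -> continuous g ->
  (forall x, is_derive x (1 : R) P (g x)) -> weak_derivative l u g ->
  forall x, 0 <= x <= l -> u x = u 0 + (P x - P 0).
Proof.
move=> l0 cu cg dP wd x xl; have cP := is_derive_continuous dP.
suff : u x - P x = u 0 - P 0 by lra.
have := @du_bois_reymond l (fun x => u x - P x) l0; apply => //; last first.
- by rewrite lexx ltW.
- move=> phi tphi; have [dphi cphi'] := test_function_derive tphi.
  have := wd _ tphi; rewrite -(weak_derivative_C1 l0 dP cg tphi) => eq.
  under eq_Rintegral do rewrite mulrBl.
  rewrite RintegralB//; first by rewrite eq subrr.
    apply: within_segment_integrable_oo => z; apply: cvgM; first exact: cu.
    exact: (continuous_subspaceT cphi').
  apply: within_segment_integrable_oo; apply: continuous_subspaceT => z.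
  by apply: cvgM; [exact: cP|exact: cphi'].
- by move=> z; apply: cvgB; [exact: cu|exact: (continuous_subspaceT cP)].
Qed.

End WeakDerivative.

(** * Torsion on an edge and on a graph *)

Section EdgeTorsion.
Variables (R : realType) (p : R) (Phi : R -> R).
Hypothesis p_gt1 : 1 < p.
Local Notation mu := (@lebesgue_measure R).
Local Notation psi := (spow (p - 1)).
Local Notation phi := (spow (p - 1)^-1).
Hypothesis dPhi : forall x : R, is_derive x (1 : R) Phi (phi x).
Implicit Types (u g F dw : R -> R) (l a x : R).

Let p1_gt0 : 0 < p - 1. Proof. by rewrite subr_gt0. Qed.

Lemma flux_inverseK : cancel psi phi.
Proof. by apply: spowK => //; rewrite divff// gt_eqF. Qed.

Lemma inverse_fluxK : cancel phi psi.
Proof. by apply: spowK; [rewrite invr_gt0|rewrite mulVf// gt_eqF]. Qed.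

Lemma inverse_flux_homo : {homo phi : x y / x < y}.
Proof. by apply: spow_homo; rewrite invr_gt0. Qed.

Lemma inverse_flux_continuous : continuous phi.
Proof. exact: homo_surj_continuous inverse_flux_homo flux_inverseK. Qed.

Lemma is_derive_reflect a x : is_derive x (1 : R) (fun x => a - x) (-1).
Proof. by rewrite -[X in is_derive _ _ _ X]sub0r; apply: is_deriveB. Qed.

Lemma torsion_profile_derive c a x :
  is_derive x (1 : R) (fun x => c + (Phi a - Phi (a - x))) (phi (a - x)).
Proof.
have dax := is_derive_reflect a x.
have dPax : is_derive x (1 : R) (fun x => Phi (a - x)) (phi (a - x) * -1).
  exact: (@is_derive1_comp _ Phi (fun x => a - x)).
rewrite -[X in is_derive _ _ _ X](_ : 0 + (0 - phi (a - x) * -1) = _); last by ring.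
by apply: is_deriveD; apply: is_deriveB.
Qed.

Lemma inverse_flux_affine_continuous a : continuous (fun x => phi (a - x)).
Proof.
move=> x; apply: (continuous_comp (f := fun x => a - x)); last exact: inverse_flux_continuous.
by apply: cvgB; [exact: cvg_cst|exact: cvg_id].
Qed.

Lemma within_measurable_oo l u : {within `[0, l], continuous u} ->
  measurable_fun `]0, l[ u.
Proof.
move=> cu; have : measurable_fun `[0, l] u.
  by apply: subspace_continuous_measurable_fun.
by apply: measurable_funS => //; exact: subset_itv_oo_cc.
Qed.

Lemma within_in_Lp l u : 0 < l -> {within `[0, l], continuous u} -> in_Lp l p u.
Proof.
move=> l0 cu; have mu_ := within_measurable_oo cu; split=> //.
rewrite -[X in integrable _ _ X]/(EFin \o (fun x => `|u x| `^ p)).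
apply: measurable_bounded_integrable; first exact: measurable_itv.
- by rewrite /= lebesgue_measure_itv/= lte_fin l0 -EFinD ltry.
- apply: (@measurableT_comp _ _ _ _ _ _ (@powR R ^~ p)) => //.
  exact: measurableT_comp.
have [M [_ hM]] := compact_bounded (continuous_compact cu (@segment_compact R 0 l)).
exists ((`|M| + 1) `^ p); split; first exact: num_real.
move=> B hB x /= xl; apply: le_trans (ltW hB).
rewrite ger0_norm ?powR_ge0//; apply: ge0_ler_powR; rewrite ?nnegrE//.
  by apply: ltW; apply: lt_trans p_gt1.
apply: hM; last by exists x => //; exact: subset_itv_oo_cc xl.
by rewrite (le_lt_trans (ler_norm M))// ltrDl.
Qed.

Lemma measurable_p_flux l g : measurable_fun `]0, l[ g ->
  measurable_fun `]0, l[ (p_flux p g).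
Proof.
move=> mg; apply: measurable_funM => //.
apply: (@measurableT_comp _ _ _ _ _ _ (@powR R ^~ (p - 2))) => //.
exact: measurableT_comp.
Qed.

Lemma p_flux_inverse_flux g x : p_flux p (fun x => phi (g x)) x = g x.
Proof. by rewrite p_flux_spow// inverse_fluxK. Qed.

Lemma torsion_profile l a : 0 < l ->
  [/\ in_Lp l p (fun x => phi (a - x)),
      weak_derivative l (fun x => - p_flux p (fun x => phi (a - x)) x) (fun=> 1) &
      continuous_representative l (p_flux p (fun x => phi (a - x))) (fun x => a - x)].
Proof.
move=> l0; split.
- apply: within_in_Lp => //; apply: continuous_subspaceT.
  exact: inverse_flux_affine_continuous.
- apply: (@eq_weak_derivative _ _ (fun x => - (a - x)) _ (cst 1)) => //.
    by move=> x _; rewrite p_flux_inverse_flux.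
  apply: weak_derivative_C1 => // [x|]; last exact: cst_continuous.
  by rewrite -[X in is_derive _ _ _ X]opprK; apply/is_deriveN/is_derive_reflect.
- split; last by apply: aeW => x _; rewrite p_flux_inverse_flux.
  apply: continuous_subspaceT => x.
  by apply: cvgB; [exact: cvg_cst|exact: cvg_id].
Qed.

(** The equation makes [F] affine of slope -1. Applying the inverse flux map shows that [dw] is
    almost everywhere the continuous function [phi (F 0 - x)], which is then integrated. *)
Lemma torsion_edge_rigid l u dw F : 0 < l ->
  {within `[0, l], continuous u} -> in_Lp l p dw -> weak_derivative l u dw ->
  weak_derivative l (fun x => - p_flux p dw x) (fun=> 1) ->
  continuous_representative l (p_flux p dw) F ->
  forall x, 0 <= x <= l ->
    F x = F 0 - x /\ u x = u 0 + (Phi (F 0) - Phi (F 0 - x)).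
Proof.
move=> l0 cu [mdw _] wu wflux [cF fluxF].
have aeS (P Q : R -> Prop) : (forall x, P x -> Q x) ->
    {ae mu, forall x, P x} -> {ae mu, forall x, Q x}.
  by move=> PQ; apply: (filterS (Filter := ae_filter_ringOfSetsType mu)).
have mF := within_measurable_oo cF.
have cNF : {within `[0, l], continuous (fun x => - F x)}.
  by move=> x; apply: cvgN; exact: cF.
have wF : weak_derivative l (fun x => - F x) (cst 1).
  apply: ae_eq_weak_derivative wflux => //.
  - by apply: measurable_funN; exact: measurable_p_flux.
  - exact: measurable_funN.
  - by apply: aeS fluxF => x /= h xl; rewrite h.
  - exact: aeW.
have FE x : 0 <= x <= l -> F x = F 0 - x.
  move=> xl; have := @weak_derivative_rigid _ l _ _ id l0 cNF
    (@cst_continuous R R 1) (fun x => is_derive_id x 1) wF x xl.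
  by rewrite subr0; lra.
move=> x xl; split; first exact: FE.
have wphi : weak_derivative l u (fun x => phi (F 0 - x)).
  apply: ae_eq_weak_derivative wu => //.
  - exact: within_measurable_oo.
  - exact: within_measurable_oo.
  - apply: within_measurable_oo; apply: continuous_subspaceT.
    exact: inverse_flux_affine_continuous.
  - exact: aeW.
  - apply: aeS fluxF => y /= h yl; rewrite -FE -?h//.
      by rewrite p_flux_spow// flux_inverseK.
    by move: yl; rewrite in_itv/= => /andP[y0 yl]; rewrite !ltW.
have := weak_derivative_rigid l0 cu (@inverse_flux_affine_continuous (F 0))
  (torsion_profile_derive 0 (F 0)) wphi xl.
by move=> ->; rewrite subr0 subrr addr0 subr0 add0r.
Qed.

End EdgeTorsion.

Section GraphTorsion.
Variables (R : realType) (G : metric_graph R) (p : R) (Phi : R -> R).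
Hypothesis p_gt1 : 1 < p.
Local Notation phi := (spow (p - 1)^-1).
Hypothesis dPhi : forall x : R, is_derive x (1 : R) Phi (phi x).
Implicit Types (VD : {set vertex G}) (w : graph_point G -> R) (e : edge G).

Definition opposite_end (h : edge_end G) : edge_end G := (h.1, ~~ h.2).

Lemma edge_point0 e : edge_point e 0 = Vertex (source e).
Proof. by rewrite /edge_point insubF ?ltxx// lexx. Qed.

Lemma edge_point_len e : edge_point e (len e) = Vertex (target e).
Proof.
by rewrite /edge_point insubF ?ltxx ?andbF// leNgt len_gt0.
Qed.

Lemma edge_point_Interior e (x : {x : R | 0 < x < len e}) :
  edge_point e (val x) = Interior x.
Proof. by rewrite /edge_point valK. Qed.

Definition edge_profile w (a : edge G -> R) : Prop :=
  forall e x, 0 <= x <= len e -> edge_restriction w e x =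
    w (Vertex (source e)) + (Phi (a e) - Phi (a e - x)).

Definition affine_flux (a : edge G -> R) (e : edge G) (x : R) : R := a e - x.

(** Reduces the problem to finitely many unknowns: the vertex values and, for each edge, the flux
    [a e] at its source. *)
Lemma p_torsionP VD w : p_torsion p VD w <-> exists a : edge G -> R,
  [/\ forall v, v \in VD -> w (Vertex v) = 0, edge_profile w a &
      forall v, v \notin VD ->
        \sum_(h in incident v) outward_flux (affine_flux a) h = 0].
Proof.
split=> [[[W wVD] [dw [F [dwP wF FP kirchhoff]]]]|[a [wVD prof kirchhoff]]].
  have rigid e := torsion_edge_rigid p_gt1 dPhi (len_gt0 e) (W e).1
    (dwP e).1 (dwP e).2 (wF e) (FP e).
  exists (fun e => F e 0); split=> // [e x xl|v /kirchhoff K].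
    by rewrite (rigid e x xl).2 /edge_restriction edge_point0.
  rewrite -[RHS]K; apply: eq_bigr => -[e b] _; rewrite /outward_flux /end_position /affine_flux/=.
  congr (_ * _); case: b; last by rewrite subr0.
  by rewrite (rigid e (len e) _).1// lexx ltW// len_gt0.
pose dw e x := phi (a e - x).
have du e := torsion_profile_derive dPhi (w (Vertex (source e))) (a e).
have wE e : {in `[0, len e], (fun x => w (Vertex (source e)) +
    (Phi (a e) - Phi (a e - x))) =1 edge_restriction w e}.
  by move=> x; rewrite in_itv/= => xl; rewrite prof.
have cw e : {within `[0, len e], continuous (edge_restriction w e)}.
  apply: (@subspace_eq_continuous _ _ _ (fun x => w (Vertex (source e)) +
    (Phi (a e) - Phi (a e - x)))).
    by move=> x; rewrite inE => xl; rewrite wE.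
  apply: continuous_subspaceT; exact: is_derive_continuous (du e).
have wdw e : weak_derivative (len e) (edge_restriction w e) (dw e).
  have wC1 := weak_derivative_C1 (len_gt0 e) (du e)
    (inverse_flux_affine_continuous p_gt1 (a:=a e)).
  apply: eq_weak_derivative wC1 => // x xl.
  by apply: wE; exact: subset_itv_oo_cc xl.
have prof_e e := torsion_profile p_gt1 (a e) (len_gt0 e).
split; first split=> // e; first split=> //.
  split; first by apply: within_in_Lp => //; exact: len_gt0.
  by exists (dw e); split=> //; case: (prof_e e).
exists dw, (affine_flux a); split=> // e; case: (prof_e e) => //.
Qed.

Lemma edge_profile_inj w1 w2 a : edge_profile w1 a -> edge_profile w2 a ->
  (forall v, w1 (Vertex v) = w2 (Vertex v)) -> w1 = w2.
Proof.
move=> p1 p2 eqV; apply/funext => -[v|e x]; first exact: eqV.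
have xl : 0 <= val x <= len e by have /andP[? ?] := valP x; rewrite !ltW.
have := p1 e _ xl; rewrite eqV -(p2 e _ xl).
by rewrite /edge_restriction edge_point_Interior.
Qed.

(** The profile formula gives the right value at the source by itself; the hypothesis is the
    matching condition at the target. *)
Lemma edge_profile_exists (U : vertex G -> R) (a : edge G -> R) :
  (forall e, Phi (a e) - Phi (a e - len e) = U (target e) - U (source e)) ->
  exists2 w, (forall v, w (Vertex v) = U v) & edge_profile w a.
Proof.
move=> aU; pose w (pt : graph_point G) := match pt with
  | Vertex v => U v
  | @Interior _ _ e x => U (source e) + (Phi (a e) - Phi (a e - val x)) end.
exists w => // e x /andP[x0 xl]; rewrite /edge_restriction.
have [->|xn0] := eqVneq x 0; first by rewrite edge_point0 /= subr0 subrr addr0.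
have [->|xnl] := eqVneq x (len e).
  by rewrite edge_point_len /= aU addrC subrK.
have xin : 0 < x < len e by rewrite !lt_neqAle x0 xl eq_sym xn0 xnl.
by rewrite -[x]/(val (exist _ x xin : {x : R | 0 < x < len e})) edge_point_Interior.
Qed.

End GraphTorsion.

(** * Existence and uniqueness through the network of vertex values *)

Theorem theorem3p2 (R : realType) (G : metric_graph R)
  (VD : {set vertex G}) (p : R)
  (hconn : connected_graph G)
  (hVD : VD != finset.set0)
  (hdeg : forall v : vertex G, v \in VD -> degree v = 1%N)
  (hp : 1 < p) :
  exists! w : graph_point G -> R, p_torsion p VD w.
Proof.
have [Phi dPhi] := continuous_primitive (inverse_flux_continuous hp).
have /choice[A AP] := fun e : edge G => edge_conductance
  (inverse_flux_homo hp) (flux_inverseK hp) (spowN (p - 1)^-1) dPhi (len_gt0 e).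
pose B (h : edge_end G) := A h.1.
(* The directed edges of the network are the edge ends, so each edge occurs in both directions, with
   the same response, and a loop occurs twice at its vertex. *)
pose tl := @end_vertex R G; pose hd h := tl (opposite_end h).
have B_homo h : {homo B h : x y / x < y} by case: (AP h.1).
have B_cont h : continuous (B h) by case: (AP h.1).
have AN e d : A e (- d) = len e - A e d by case: (AP e).
(* The symmetry at [d = 0] gives [A e 0 = len e / 2]. *)
have B0 h : 0 <= B h 0.
  by have := AN h.1 0; have := len_gt0 h.1; rewrite oppr0 /B; lra.
have B_coercive h K : exists C, forall x, K <= B h x -> - C <= x.
  have [_ _ _ AK _] := AP h.1.
  exists (- (Phi K - Phi (K - len h.1))) => x; rewrite opprK -{1}(AK K) leNgt.
  by apply: contraNle => /B_homo.
have flux_divergence (U : vertex G -> R) v :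
    \sum_(h in incident v) outward_flux
      (affine_flux (fun e => A e (U (target e) - U (source e)))) h =
    divergence tl hd B U v.
  apply: eq_big => [h|[e b]]; rewrite inE//= => /eqP.
  rewrite /outward_flux /affine_flux /hd /tl /B /opposite_end /end_vertex/= => <-.
  (* At the target the outward flux is [len e - A e d], which the symmetry turns into [A e (- d)],
     the response seen from that end. *)
  case: b => /=; last by rewrite subr0 mul1r.
  by rewrite -[U (source e) - _]opprB AN mulN1r opprB.
have torsionE w : p_torsion p VD w ->
    [/\ forall v, v \in VD -> w (Vertex v) = 0,
        edge_profile Phi w
          (fun e => A e (w (Vertex (target e)) - w (Vertex (source e)))) &
        forall v, v \notin VD -> divergence tl hd B (w \o Vertex) v = 0].
  move=> /(p_torsionP hp dPhi)[a [wVD prof kirchhoff]].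
  (* The profile at [x = len e] prescribes the increment along the edge, and [A e] recovers the flux
     from it. *)
  have aE : a = fun e => A e (w (Vertex (target e)) - w (Vertex (source e))).
    apply/funext => e; have [_ _ _ AK _] := AP e.
    have := prof e (len e); rewrite lexx ltW ?len_gt0// => /(_ isT).
    by rewrite /edge_restriction edge_point_len => ->; rewrite addrC addKr AK.
  by rewrite aE in prof kirchhoff; split=> // v /kirchhoff; rewrite (flux_divergence (w \o Vertex)).
have [U [UVD UK]] := network_solution hconn hVD B_homo B_cont B0 B_coercive.
have [|w wU prof] := @edge_profile_exists _ _ Phi U
  (fun e => A e (U (target e) - U (source e))).
  by move=> e; case: (AP e).
have tw : p_torsion p VD w.
  apply/(p_torsionP hp dPhi).
  exists (fun e => A e (U (target e) - U (source e))); split=> //.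
    by move=> v /UVD; rewrite wU.
  by move=> v /UK; rewrite flux_divergence.
exists w; split=> // w' /torsionE[w'VD prof' w'K].
have [wVD _ wK] := torsionE _ tw.
(* Both families of vertex values solve the network problem, so comparison applies in both
   directions; equal vertex values then give equal fluxes and profiles. *)
have eqV v : w (Vertex v) = w' (Vertex v).
  apply/le_anti/andP; split.
    apply: (comparison hconn hVD B_homo (U := w \o Vertex) (W := w' \o Vertex)) => x xD.
    - by rewrite wK.
    - by rewrite w'K.
    - by rewrite /= wVD ?w'VD.
  apply: (comparison hconn hVD B_homo (U := w' \o Vertex) (W := w \o Vertex)) => x xD.
  - by rewrite w'K.
  - by rewrite wK.
  - by rewrite /= wVD ?w'VD.
have aE : (fun e => A e (U (target e) - U (source e))) =
    fun e => A e (w' (Vertex (target e)) - w' (Vertex (source e))).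
  by apply/funext => e; rewrite -!eqV !wU.
by apply: edge_profile_inj prof _ (eqV); rewrite aE.
Qed.
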